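(* Let $X$ be a decomposable continuum and let $p,q\in X$ be such that no proper subcontinuum of $X$ contains both $p$ and $q$. Let $C=X\setminus\kappa(q)$ and $D=X\setminus\kappa(p)$. Then: (1) $\{C,D\}\subseteq 2^X$ if and only if $|\mathcal{NB}(\mathcal{F}_1(X))|=3$. Furthermore, in this case, $\mathcal{NB}(\mathcal{F}_1(X))=\{C,D,C\cup D\}$. (2) $|\{C,D\}\cap 2^X|=1$ if and only if $|\mathcal{NB}(\mathcal{F}_1(X))|=1$. Furthermore, in this case, $\mathcal{NB}(\mathcal{F}_1(X))=\{C,D\}\cap 2^X$. (3) $\{C,D\}\cap 2^X=\emptyset$ if and only if $\mathcal{NB}(\mathcal{F}_1(X))=\emptyset$.
   Context: A continuum is a compact connected metric space; a subcontinuum of $X$ is a non-empty closed connected subset of $X$. A continuum is decomposable if it is the union of two proper subcontinua. $2^X$ denotes the collection of all non-empty closed subsets of $X$. For $z\in X$, the composant of $z$ is $\kappa(z)=\bigcup\{L: L \text{ is a proper subcontinuum of } X \text{ and } z\in L\}$. For $B\in 2^X\setminus\{X\}$ and $x\in X\setminus B$, $B$ does not block $\{x\}$ if the union of all subcontinua of $X$ that contain $x$ and are contained in $X\setminus B$ is dense in $X$. $\mathcal{NB}(\mathcal{F}_1(X))$ is the collection of all $B\in 2^X\setminus\{X\}$ such that $B$ does not block $\{x\}$ for each $x\in X\setminus B$. *)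

(* Defs.v *)
From mathcomp Require Import all_boot all_order all_algebra.
From mathcomp Require Import classical_sets functions cardinality reals topology.
Set Implicit Arguments.
Unset Strict Implicit.
Unset Printing Implicit Defensive.

Local Open Scope classical_set_scope.

Definition continuum (R : realType) (X : metricType R) : Prop :=
  compact [set: X] /\ connected [set: X].

Definition subcontinuum (R : realType) (X : metricType R) (L : set X) : Prop :=
  [/\ L !=set0, closed L & connected L].

Definition proper_subcontinuum (R : realType) (X : metricType R) (L : set X) :
    Prop :=
  subcontinuum L /\ L <> [set: X].

Definition decomposable (R : realType) (X : metricType R) : Prop :=
  exists A B : set X,
    [/\ proper_subcontinuum A, proper_subcontinuum B & A `|` B = [set: X]].

(* The hyperspace 2^X. *)
Definition hyperspace (R : realType) (X : metricType R) : set (set X) :=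
  [set B | B !=set0 /\ closed B].

Definition composant (R : realType) (X : metricType R) (z : X) : set X :=
  \bigcup_(L in [set L : set X | proper_subcontinuum L /\ L z]) L.

(* "B does not block {x}"; only meaningful for B in 2^X \ {X} and x not in B. *)
Definition does_not_block (R : realType) (X : metricType R) (B : set X)
    (x : X) : Prop :=
  dense (\bigcup_(L in [set L : set X |
                         [/\ subcontinuum L, L x & L `<=` ~` B]]) L).

(* NB(F_1(X)), where F_1(X) is the family of singletons of X. *)
Definition NBF1 (R : realType) (X : metricType R) : set (set X) :=
  [set B | [/\ hyperspace B, B <> [set: X] &
               forall x : X, (~` B) x -> does_not_block B x]].

Arguments hyperspace {R} X.
Arguments NBF1 {R} X.

(* Main.v *)
Require Import Defs.
From mathcomp Require Import all_boot all_order all_algebra.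
From mathcomp Require Import classical_sets functions cardinality reals topology.
From mathcomp Require Import boolp filter.

(** Write C for the complement of the composant of q and D for that of the
composant of p.  A point lies in C exactly when X is irreducible between it and
q; thus C is the end of X at p and D is the end of X at q.  The theorem is read
off from [NBF1E]: the members of NB(F_1(X)) are C when C is closed, D when D is
closed, and the union of C and D when both are closed, and nothing else.

Decomposability enters through a cover of X by two continua A, containing p but
not q, and B, containing q but not p.  It makes C and D disjoint, and X
irreducible between any point of C and any point of D ([irreducible_ends]).

These sets are members.  If C is closed, two points of the composant of q are
joined inside it by the union of two continua through q, and a composant is
dense by boundary bumping.  If C and D are both closed and x is outside both,
let Y be the closure of the union of the continua through x that avoid both.
Bumping inside a proper continuum through x and q, which avoids C, shows that Y
meets D, and by symmetry Y meets C; so Y is X by [irreducible_ends].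

Nothing else is a member.  Let N be in NB(F_1(X)).  If some c in C and some d
in D were outside N, then continua leaving c and d and avoiding N could be made
to overlap, and their union would be X; so N contains C or D.  The key tool is
then [NBF1_end_continuum], an instance of [disjoint_end_continuum]: if D is
contained in N, every proper continuum M through p is disjoint from some
continuum S through q with nonempty interior.
Suppose that N contains D and C and some further point y.  Join y to p by a
proper continuum M and to q by a proper continuum L, and take continua S
through q missing M and S' through p missing L, both with interior.  From a
point outside N, continua avoiding N reach both S and S'; together with S and
S' they form a continuum through p and q, which is all of X although it misses
y.  A variant of this argument deals with the case in which N contains only one
of the two ends. *)

Set Implicit Arguments.
Unset Strict Implicit.

Local Open Scope classical_set_scope.
Local Open Scope card_scope.

(** * Connectedness and boundary bumping in compact Hausdorff spaces *)

Lemma connected_sub_closed (T : topologicalType) (A P Q : set T) :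
  connected A -> closed P -> closed Q -> A `<=` P `|` Q ->
  A `&` (P `&` Q) = set0 -> A `&` P !=set0 -> A `<=` P.
Proof.
move=> cA cP cQ APQ dis AP0; apply/setIidPl.
apply: cA => //; last by exists P.
exists (~` Q); first exact: closed_openC.
apply/seteqP; split=> x [Ax Hx]; split=> //.
  by move=> Qx; have : set0 x by rewrite -dis.
by case: (APQ x Ax).
Qed.

(** In a closed set, a separation is a splitting into two disjoint closed sets
of the whole space; fixing the piece that holds a base point removes the
symmetric case from the applications. *)
Lemma closed_connected (T : topologicalType) (A : set T) (x : T) :
  closed A -> A x ->
  (forall P Q, closed P -> closed Q -> A = P `|` Q -> P `&` Q = set0 ->
     P x -> Q = set0) ->
  connected A.
Proof.
move=> clA Ax H; apply: contrapT => /connectedPn [E [E0 AE sE]].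
have clE b : closed (E b).
  apply/closure_id/seteqP; split; first exact: subset_closure.
  move=> y Ey; have Ay : A y.
    rewrite (closure_id A).1//; apply: closureS Ey; rewrite AE.
    by case: b; [exact: subsetUr|exact: subsetUl].
  have [s1 s2] := sE; move: Ay; rewrite AE.
  case: b Ey => Ey [] // Ey'; suff : set0 y by [].
    by rewrite -s2.
  by rewrite -s1.
have dis := separated_disjoint sE.
move: (Ax); rewrite AE => -[Ex|Ex].
  have /eqP := H _ _ (clE _) (clE _) AE dis Ex; exact/negP/set0P/(E0 true).
rewrite setUC in AE; rewrite setIC in dis.
have /eqP := H _ _ (clE _) (clE _) AE dis Ex; exact/negP/set0P/(E0 false).
Qed.

(** Otherwise the sets [A `\` O], for [A] in the family, would generate a proper
filter, and a cluster point of it would lie in every [A] but not in [O]. *)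
Lemma directed_closed_sub_open (T : topologicalType) (F : set (set T))
    (O : set T) :
  compact [set: T] -> open O -> F !=set0 -> (forall A, F A -> closed A) ->
  (forall A B, F A -> F B -> exists2 C, F C & C `<=` A `&` B) ->
  \bigcap_(A in F) A `<=` O -> exists2 A, F A & A `<=` O.
Proof.
move=> cT oO [A0 FA0] clF dirF FO; apply: contrapT => nF.
have PF : ProperFilter (filter_from F (fun A => A `\` O)).
  apply: filter_from_proper; last first.
    move=> A FA; apply/set0P/eqP => A0'; apply: nF; exists A => // x Ax.
    by apply: contrapT => nOx; have : set0 x by rewrite -A0'.
  apply: filter_from_filter; first by exists A0.
  move=> A B FA FB; have [C FC CAB] := dirF _ _ FA FB; exists C => //.
  by move=> x [/CAB[Ax Bx] nOx].
have [|z [_ clz]] := cT _ PF; first exact: filterT.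
have zA A : F A -> (A `\` O) z.
  move=> FA; have clAO : closed (A `\` O).
    by rewrite setDE; apply: closedI; [exact: clF|exact: open_closedC].
  apply: clAO => B Bz; apply: clz => //.
  by exists A.
have [_] := zA _ FA0; apply; apply: FO => A FA; by case: (zA _ FA).
Qed.

Lemma closed_shrink (T : topologicalType) (K W : set T) :
  hausdorff_space T -> compact [set: T] -> closed K -> open W -> K `<=` W ->
  exists V, [/\ open V, K `<=` V & closure V `<=` W].
Proof.
move=> hT cT clK oW KW.
have KnW : set_nbhs K W by apply/set_nbhsP; exists W; split.
have [V /set_nbhsP[V' [oV' KV' V'V]] VW] := compact_normal hT cT clK KnW.
exists V'; split => //; exact: subset_trans (closureS V'V) VW.
Qed.

(** The sets intersected here are the relatively clopen subsets of [E] that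
contain [x], provided that [E] is closed. *)
Definition quasicomponent (T : topologicalType) (E : set T) (x : T) : set T :=
  \bigcap_(P in [set P | [/\ closed P, closed (E `\` P), P `<=` E & P x]]) P.

Lemma quasicomponent_sub_clopen (T : topologicalType) (E O : set T) (x : T) :
  compact [set: T] -> closed E -> E x -> open O ->
  quasicomponent E x `<=` O ->
  exists P, [/\ closed P, closed (E `\` P), P x, P `<=` E & P `<=` O].
Proof.
move=> cT clE Ex oO QO.
have [| | |P [clP clEP PE Px] PO] := directed_closed_sub_open cT oO _ _ _ QO.
- by exists E; split => //; rewrite setDv; exact: closed0.
- by move=> A [].
- move=> A B [cA cEA AE Ax] [cB cEB BE Bx]; exists (A `&` B) => //.
  split => //; first exact: closedI.
    by rewrite setDIr; exact: closedU.
  by move=> y [/AE].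
by exists P.
Qed.

(** If the quasicomponent split into disjoint closed sets [P], containing [x],
and [Q], normality would give an open [V] around [P] whose closure misses [Q].
By compactness some relatively clopen [F] lies in [V] together with the
exterior of [V]; then [F `&` V] is relatively clopen as well and cuts off
[Q]. *)
Lemma quasicomponent_connected (T : topologicalType) (E : set T) (x : T) :
  hausdorff_space T -> compact [set: T] -> closed E -> E x ->
  connected (quasicomponent E x).
Proof.
move=> hT cT clE Ex.
have clQ : closed (quasicomponent E x) by apply: closed_bigI => P [].
apply: (closed_connected (x := x)) => //; first by move=> A [].
move=> P Q cP cQ QPQ PQ0 Px.
have [|V [oV PV VQ]] := closed_shrink hT cT cP (closed_openC cQ).
  by apply/disjoints_subset.
have [||F [cF cEF Fx FE FO]] := @quasicomponent_sub_clopen _ E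
    (V `|` ~` closure V) x cT clE Ex.
- by apply: openU => //; exact/closed_openC/closed_closure.
- rewrite QPQ => y [/PV|Qy]; first by left.
  by right => /VQ.
have FVE : F `&` closure V = F `&` V.
  apply/seteqP; split=> y [Fy Vy]; split => //; last exact: subset_closure.
  by case: (FO _ Fy).
have QV : quasicomponent E x `<=` F `&` V.
  rewrite -FVE; apply: bigcap_inf; split.
  - by apply: closedI => //; exact: closed_closure.
  - have -> : E `\` (F `&` closure V) = (E `\` F) `|` (F `&` ~` V).
      rewrite FVE; apply/seteqP; split=> y.
        move=> [Ey nFV]; have [Fy|nFy] := pselect (F y); last by left.
        by right; split => // Vy; apply: nFV.
      move=> [[Ey nFy]|[Fy nVy]]; split => //; [by case|exact: FE|by case].
    by apply: closedU => //; apply: closedI => //; exact: open_closedC.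
  - by move=> y [/FE].
  - by split => //; exact/subset_closure/PV.
rewrite -subset0 => y Qy.
have : (F `&` V) y by apply: QV; rewrite QPQ; right.
by move=> [_ /subset_closure /VQ].
Qed.

(** Enlarge [K] to an open [V] whose closure lies in [W] and avoids [x].  The
quasicomponent of [x] in [L `\` V] must reach the closure of [V]: otherwise a
relatively clopen neighbourhood of it, disjoint from that closure, would also
be clopen in [L]. *)
Lemma boundary_bumping (T : topologicalType) (L K W : set T) (x : T) :
  hausdorff_space T -> compact [set: T] -> closed L -> connected L -> L x ->
  closed K -> ~ K x -> open W -> K `<=` W -> L `&` K !=set0 ->
  exists S, [/\ closed S, connected S, S x, S `<=` L `\` K & S `&` W !=set0].
Proof.
move=> hT cT clL cL Lx clK nKx oW KW LK0.
have clx : closed [set x].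
  by apply: accessible_closed_set1; exact: hausdorff_accessible.
have [| |V [oV KV VW]] :=
    @closed_shrink _ K (W `&` ~` [set x]) hT cT clK.
- by apply: openI => //; exact: closed_openC.
- by move=> y Ky; split; [exact: KW|move=> yx; apply: nKx; rewrite -yx].
have nVx : ~ closure V x by move=> /VW [_]; exact.
pose E := L `\` V.
have clE : closed E.
  by rewrite /E setDE; apply: closedI => //; exact: open_closedC.
have Ex : E x by split => // /subset_closure.
exists (quasicomponent E x); split.
- by apply: closed_bigI => P [].
- exact: quasicomponent_connected.
- by move=> P [].
- apply: (@subset_trans _ E); last by move=> y [Ly nVy]; split => // /KV.
  by apply: bigcap_inf; split => //; rewrite setDv; exact: closed0.
suff [y [Qy Vy]] : quasicomponent E x `&` closure V !=set0.
  by exists y; split => //; case: (VW _ Vy).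
apply: contrapT => nQ.
have [||P [cP cEP Px PE PV]] := @quasicomponent_sub_clopen _ E
    (~` closure V) x cT clE Ex.
- exact/closed_openC/closed_closure.
- by move=> y Qy Vy; apply: nQ; exists y.
have LP : L `<=` P.
  apply: (connected_sub_closed (Q := (E `\` P) `|` (L `&` closure V))) => //.
  - by apply: closedU => //; apply: closedI => //; exact: closed_closure.
  - move=> y Ly; have [Py|nPy] := pselect (P y); first by left.
    right; have [Vy|nVy] := pselect (V y).
      by right; split => //; exact: subset_closure.
    by left.
  - rewrite -subset0 => y [Ly [Py [[]//|[_ Vy]]]].
    exact: (PV y).
  - by exists x.
have [y [Ly Ky]] := LK0.
by apply: (PV y (LP _ Ly)); exact/subset_closure/KV.
Qed.

(** * Irreducible continua and composants *)

Definition irreducible_between (R : realType) (X : metricType R) (p q : X) :=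
  forall L : set X, subcontinuum L -> L p -> L q -> L = [set: X].

Lemma irreducible_betweenC (R : realType) (X : metricType R) (p q : X) :
  irreducible_between p q -> irreducible_between q p.
Proof. by move=> irr L sL Lq Lp; exact: irr. Qed.

Lemma composantP (R : realType) (X : metricType R) (z x : X) :
  composant z x <->
  exists L : set X, [/\ subcontinuum L, L <> [set: X], L z & L x].
Proof.
split=> [[L [[sL LT] Lz] Lx]|[L [sL LT Lz Lx]]]; first by exists L.
by exists L.
Qed.

(** Lets the complement of a composant be handled as a set of endpoints of
irreducibility rather than as a complement. *)
Lemma notin_composantP (R : realType) (X : metricType R) (z x : X) :
  (~` composant z) x <-> irreducible_between x z.
Proof.
split=> [nzx L sL Lx Lz|irr /composantP[L [sL LT Lz Lx]]].
  by apply: contrapT => LT; apply: nzx; apply/composantP; exists L.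
by apply: LT; exact: irr.
Qed.

Lemma subcontinuumU (R : realType) (X : metricType R) (A B : set X) (x : X) :
  subcontinuum A -> subcontinuum B -> A x -> B x -> subcontinuum (A `|` B).
Proof.
move=> [A0 cA coA] [B0 cB coB] Ax Bx; split; first by exists x; left.
  exact: closedU.
by apply: connectedU => //; exists x.
Qed.

Lemma subcontinuum_closed (R : realType) (X : metricType R) (A : set X) :
  subcontinuum A -> closed A.
Proof. by case. Qed.

Lemma subcontinuum_openC (R : realType) (X : metricType R) (A : set X) :
  subcontinuum A -> open (~` A).
Proof. by move=> [_ clA _]; exact: closed_openC. Qed.

(** The classical fact that a continuum together with one side of a separation
of its complement is again a continuum: a clopen piece of the union that misses
[M] would lie in [U], away from [V], and so would be clopen in the space. *)
Lemma connected_setU_separated (T : topologicalType) (M U V : set T) :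
  connected [set: T] -> closed M -> connected M -> M !=set0 ->
  ~` M = U `|` V -> separated U V -> closed (M `|` U) /\ connected (M `|` U).
Proof.
move=> cT clM cM [m Mm] MUV sUV; have [s1 s2] := sUV.
have cover x : M x \/ (U x \/ V x).
  have [Mx|nMx] := pselect (M x); [by left|right].
  by rewrite -[_ \/ _]/((U `|` V) x) -MUV.
have clMU : closed (M `|` U).
  apply/closure_id/seteqP; split; first exact: subset_closure.
  rewrite closureU -(closure_id M).1// => x [Mx|Ux]; first by left.
  case: (cover x) => [|[|Vx]]; [by left|by right|].
  by have : set0 x by rewrite -s1.
have clMV : closed (M `|` V).
  apply/closure_id/seteqP; split; first exact: subset_closure.
  rewrite closureU -(closure_id M).1// => x [Mx|Vx]; first by left.
  case: (cover x) => [|[Ux|]]; [by left| |by right].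
  by have : set0 x by rewrite -s2.
split => //.
have nUV x : U x -> ~ V x.
  by move=> Ux Vx; have : set0 x by rewrite -(separated_disjoint sUV).
apply: (closed_connected (x := m)) => //; first by left.
move=> P Q cP cQ E PQ Pm.
have nPQ x : P x -> ~ Q x by move=> Px Qx; have : set0 x by rewrite -PQ.
have MP : M `<=` P.
  apply: (connected_sub_closed (Q := Q)) => //.
  - by move=> x Mx; rewrite -E; left.
  - by rewrite PQ setI0.
  - by exists m.
have QU x : Q x -> U x.
  move=> Qx; have : (M `|` U) x by rewrite E; right.
  by case=> // /MP /nPQ.
rewrite -subset0 => x Qx.
have : [set: T] `<=` P `|` (M `|` V).
  apply: (connected_sub_closed (Q := Q)) => //; first exact: closedU.
  - move=> y _; case: (cover y) => [My|[Uy|Vy]].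
    + by left; left; exact: MP.
    + have : (M `|` U) y by right.
      by rewrite E => -[Py|Qy]; [left; left|right].
    + by left; right; right.
  - rewrite -subset0 => y [_ [[Py|[My|Vy]] Qy]]; first exact: (nPQ y).
      by exact: (nPQ y (MP _ My)).
    by exact: (nUV y (QU _ Qy)).
  - by exists m; split => //; left.
move=> /(_ x I) [Px|[Mx|Vx]]; first exact: (nPQ x).
  by exact: (nPQ x (MP _ Mx)).
by exact: (nUV x (QU _ Qx)).
Qed.

(** If [U] and [V] separated the complement of [M], then [M `|` U] and [M `|` V]
would be continua through [p]; the one that contains [q] would be the whole
space and leave the other side empty. *)
Lemma closure_compl_subcontinuum (R : realType) (X : metricType R) (p q : X)
    (M : set X) :
  continuum X -> irreducible_between p q -> subcontinuum M -> M p ->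
  M <> [set: X] -> subcontinuum (closure (~` M)) /\ closure (~` M) q.
Proof.
move=> [_ cX] irr sM Mp MT; have [_ clM cM] := sM.
have nMq : ~ M q by move=> Mq; apply: MT; exact: irr.
have clq : closure (~` M) q by exact: subset_closure.
split => //; split; [by exists q|exact: closed_closure|].
apply: connected_closure; apply: contrapT => /connectedPn[E [E0 ME sE]].
have M0 : M !=set0 by exists p.
have absurd U V : ~` M = U `|` V -> separated U V -> V !=set0 -> ~ U q.
  move=> MUV sUV [v Vv] Uq.
  have [clMU cMU] := connected_setU_separated cX clM cM M0 MUV sUV.
  have MU : M `|` U = [set: X].
    by apply: irr; [split => //; exists p; left|left|right].
  have : (M `|` U) v by rewrite MU.
  have nMv : (~` M) v by rewrite MUV; right.
  by move=> [//|Uv]; have : set0 v by rewrite -(separated_disjoint sUV).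
have : (~` M) q by [].
rewrite ME => -[]; first exact: absurd ME sE (E0 true).
by apply: absurd (E0 false); rewrite 1?setUC// separatedC.
Qed.

Lemma subcontinuum_bumping (R : realType) (X : metricType R) (L K W : set X)
    (x : X) :
  continuum X -> subcontinuum L -> L x -> closed K -> ~ K x -> open W ->
  K `<=` W -> L `&` K !=set0 ->
  exists S, [/\ subcontinuum S, S x, S `<=` L, S `<=` ~` K & S `&` W !=set0].
Proof.
move=> [cX _] [L0 clL cL] Lx clK nKx oW KW LK.
have [S [clS cS Sx SL SW]] :=
  boundary_bumping (@metric_hausdorff _ X) cX clL cL Lx clK nKx oW KW LK.
exists S; split => //; first by split => //; exists x.
  by move=> y /SL[].
by move=> y /SL[].
Qed.

Lemma closed_point (R : realType) (X : metricType R) (x : X) : closed [set x].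
Proof.
apply: accessible_closed_set1; apply: hausdorff_accessible.
exact: metric_hausdorff.
Qed.

Lemma subcontinuumT (R : realType) (X : metricType R) (x : X) :
  continuum X -> subcontinuum [set: X].
Proof. by move=> [_ cX]; split => //; exists x. Qed.

Lemma composant_refl (R : realType) (X : metricType R) (p q : X) :
  p <> q -> composant q q.
Proof.
move=> pq; apply/composantP; exists [set q]; split => //.
  split; [by exists q|exact: closed_point|exact: connected1].
by move=> qT; apply: pq; have : [set: X] p by []; rewrite -qT.
Qed.

(** Bumping [q] out of the whole space towards a point [z] of the open set gives
a continuum that reaches the open set and is proper because it avoids [z]. *)
Lemma composant_dense (R : realType) (X : metricType R) (p q : X) :
  continuum X -> p <> q -> dense (composant q).
Proof.
move=> cX pq O [z Oz] oO.
have [qz|zq] := pselect (q = z).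
  by exists z; split => //; rewrite -qz; exact: composant_refl pq.
have [//||S [sS Sq _ nSz [y [Sy Oy]]]] := subcontinuum_bumping cX
    (subcontinuumT q cX) I (closed_point (x := z)) zq oO.
- by move=> _ ->.
- by exists z.
exists y; split => //; apply/composantP; exists S; split => //.
by move=> ST; apply: (nSz z) => //; rewrite ST.
Qed.

(** * The two ends of a decomposable irreducible continuum *)

Lemma irreducible_decomposition (R : realType) (X : metricType R) (p q : X) :
  continuum X -> decomposable X -> irreducible_between p q ->
  exists A B : set X, [/\ subcontinuum A, subcontinuum B, A `|` B = [set: X],
    [/\ A p, ~ A q, B q & ~ B p] & A `&` B !=set0].
Proof.
move=> [_ cX] [A [B [[sA AT] [sB BT] AB]]] irr.
have [A0 clA _] := sA; have [[b Bb] clB _] := sB.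
have cover x : A x \/ B x by rewrite -[_ \/ _]/((A `|` B) x) AB.
have AB0 : A `&` B !=set0.
  apply: contrapT => nAB; apply: AT; rewrite -subTset.
  apply: (connected_sub_closed (Q := B)) => //; rewrite ?AB ?setTI//.
  by rewrite -subset0 => x ABx; apply: nAB; exists x.
have nA : A p -> ~ A q by move=> Ap Aq; apply: AT; exact: irr.
have nB : B p -> ~ B q by move=> Bp Bq; apply: BT; exact: irr.
have [Ap|Bp] := cover p.
  have Bq : B q by case: (cover q) => // /(nA Ap).
  exists A, B; split => //; split => //; first exact: nA.
  by move=> /nB.
have Aq : A q by case: (cover q) => // /(nB Bp).
exists B, A; split; rewrite 1?setUC 1?setIC//.
split => //; first exact: nB.
by move=> /nA.
Qed.

(** Irreducibility with [q] forces [x] into the part [A] of the decomposition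
that contains [p]; likewise [p] forces [y] into the other part [B].  A continuum [L] through
[x] and [y] then links [B] to [x] and [A] to [y], so [B `|` L] and [A `|` L]
are both everything; hence [L] contains [p] and [q]. *)
Lemma irreducible_ends (R : realType) (X : metricType R) (p q x y : X) :
  continuum X -> decomposable X -> irreducible_between p q ->
  irreducible_between x q -> irreducible_between y p ->
  irreducible_between x y.
Proof.
move=> cX dX irr irrx irry L sL Lx Ly.
have [A [B [sA sB AB [Ap nAq Bq nBp] _]]] :=
  irreducible_decomposition cX dX irr.
have cover z : A z \/ B z by rewrite -[_ \/ _]/((A `|` B) z) AB.
have Ax : A x.
  by case: (cover x) => // Bx; case: nBp; rewrite (irrx B).
have By : B y.
  by case: (cover y) => // Ay; case: nAq; rewrite (irry A).
have BL : B `|` L = [set: X].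
  by apply: irrx; [exact: (subcontinuumU (x := y))|right|left].
have AL : A `|` L = [set: X].
  by apply: irry; [exact: (subcontinuumU (x := x))|right|left].
apply: irr => //.
  by have [] // : (B `|` L) p by rewrite BL.
by have [] // : (A `|` L) q by rewrite AL.
Qed.

Lemma ends_disjoint (R : realType) (X : metricType R) (p q x : X) :
  continuum X -> decomposable X -> irreducible_between p q ->
  irreducible_between x q -> ~ irreducible_between x p.
Proof.
move=> cX dX irr irrq irrp.
have [A [B [sA sB AB [Ap nAq Bq nBp] _]]] :=
  irreducible_decomposition cX dX irr.
have [Ax|Bx] : (A `|` B) x by rewrite AB.
  by apply: nAq; rewrite (irrp A).
by apply: nBp; rewrite (irrq B).
Qed.

(** Let [K] be the closure of the complement of [M].  Bumping inside [K] from
[q] towards [z] gives a continuum [S] through [q] that avoids [z] and reaches a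
point of [W], which a proper continuum [M'] joins to [p].  Then [M'] and [S]
cover the space, so [M'] is a neighbourhood of [z]; hence the closure of the
complement of [M `|` M'] avoids [z].  That closure is the continuum sought: if
it met [M], its union with [M] would join [p] to [q] and yet miss [z]. *)
Lemma disjoint_end_continuum (R : realType) (X : metricType R) (p q z : X)
    (M W : set X) :
  continuum X -> irreducible_between p q ->
  subcontinuum M -> M p -> M <> [set: X] ->
  open W -> W z -> W `<=` ~` M -> W `<=` composant p ->
  exists S O, [/\ subcontinuum S, S q, S `<=` ~` M &
    [/\ open O, O !=set0 & O `<=` S]].
Proof.
move=> cX irr sM Mp MT oW Wz WM Wp.
have [sK Kq] := closure_compl_subcontinuum cX irr sM Mp MT.
have Dq : (~` composant p) q.
  by apply/notin_composantP; exact: irreducible_betweenC.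
have zq : ~ [set z] q by move=> qz; apply: Dq; apply: Wp; rewrite qz.
have [||S [sS Sq SK nSz [z' [Sz' Wz']]]] :=
    subcontinuum_bumping cX sK Kq (closed_point (x := z)) zq oW.
- by move=> _ ->.
- by exists z; split => //; apply: subset_closure; exact: WM.
have /composantP[M' [sM' M'T M'p M'z']] := Wp _ Wz'.
have M'S : M' `|` S = [set: X].
  by apply: irr; [exact: (subcontinuumU (x := z'))|left|right].
have sMM' : subcontinuum (M `|` M') by exact: (subcontinuumU (x := p)).
have nq : ~ (M `|` M') q.
  by move=> [Mq|M'q]; [apply: MT|apply: M'T]; exact: irr.
have [sK' K'q] : subcontinuum (closure (~` (M `|` M'))) /\
    closure (~` (M `|` M')) q.
  apply: (closure_compl_subcontinuum (p := p)) => //; first by left.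
  by move=> MT'; apply: nq; rewrite MT'.
have nK'z : ~ closure (~` (M `|` M')) z.
  (* the complement of S is a neighbourhood of z and lies in M' *)
  move=> /(_ (~` S)) [|y [nMy nSy]].
    apply: open_nbhs_nbhs; split; first exact: subcontinuum_openC.
    by move=> Sz; exact: (nSz z).
  have : (M' `|` S) y by rewrite M'S.
  by case=> // M'y; apply: nMy; right.
exists (closure (~` (M `|` M'))), (~` (M `|` M')); split => //.
  move=> y K'y My.
  have KM : closure (~` (M `|` M')) `|` M = [set: X].
    by apply: irr; [exact: (subcontinuumU (x := y))|right|left].
  have : (closure (~` (M `|` M')) `|` M) z by rewrite KM.
  by case=> //; exact: WM.
split; [exact: subcontinuum_openC|by exists q|exact: subset_closure].
Qed.

(** * Members contain an end, and nothing besides the ends *)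

Lemma does_not_block_reach (R : realType) (X : metricType R) (N O : set X)
    (x : X) :
  does_not_block N x -> open O -> O !=set0 ->
  exists L, [/\ subcontinuum L, L x, L `<=` ~` N & L `&` O !=set0].
Proof.
move=> nbx oO O0; have [y [Oy [L [sL Lx LN] Ly]]] := nbx O O0 oO.
by exists L; split => //; exists y.
Qed.

Lemma NBF1_proper (R : realType) (X : metricType R) (N : set X) :
  NBF1 X N -> exists x, ~ N x.
Proof.
move=> [_ NT _]; apply: contrapT => H; apply: NT; rewrite -subTset => x _.
by apply: contrapT => nNx; apply: H; exists x.
Qed.

(** A continuum that avoids [N] and leaves [M] provides a point around which the
complement of [M] consists of points outside [N], hence of points of the
composant of [p]. *)
Lemma NBF1_end_continuum (R : realType) (X : metricType R) (p q : X)
    (M N : set X) :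
  continuum X -> irreducible_between p q -> NBF1 X N ->
  ~` composant p `<=` N -> subcontinuum M -> M p -> M <> [set: X] ->
  exists S O, [/\ subcontinuum S, S q, S `<=` ~` M &
    [/\ open O, O !=set0 & O `<=` S]].
Proof.
move=> cX irr NN pN sM Mp MT.
have oM : open (~` M) by exact: subcontinuum_openC.
have [x nNx] := NBF1_proper NN.
have [[_ clN] _ nb] := NN.
have [|L [_ _ LN [z [Lz nMz]]]] := does_not_block_reach (nb x nNx) oM.
  by exists q => Mq; apply: MT; exact: irr.
apply: (disjoint_end_continuum (p := p) (z := z) (W := ~` M `&` ~` N)) => //.
- by apply: openI => //; exact: closed_openC.
- by split; [exact: nMz|exact: LN].
- by move=> y [_ nNy]; apply: contrapT => /pN.
Qed.

(** This is used contrapositively: a member that misses a point of one end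
contains the whole other end.  If both [x] and [y] were outside [N], a
continuum [K] from [y] reaching [A] would contain the complement of [A], and a
continuum from [x] leaving [A] would meet [K]; by [irreducible_ends] the two
would cover the nonempty set [N] which they avoid. *)
Lemma NBF1_contains_end (R : realType) (X : metricType R) (p q x y : X)
    (N : set X) :
  continuum X -> decomposable X -> irreducible_between p q -> NBF1 X N ->
  irreducible_between x q -> irreducible_between y p ->
  N x \/ N y.
Proof.
move=> cX dX irr [[[n Nn] _] _ nb] irrx irry.
apply: contrapT => /not_orP[nNx nNy].
have [A [B [sA sB AB [Ap nAq Bq nBp] _]]] :=
  irreducible_decomposition cX dX irr.
have [||K [sK Ky KN [b [Kb nBb]]]] :=
  @does_not_block_reach _ _ _ (~` B) _ (nb y nNy).
- exact: subcontinuum_openC.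
- by exists p.
have Ab : A b by have [] // : (A `|` B) b by rewrite AB.
have KA : K `|` A = [set: X].
  by apply: irry; [exact: (subcontinuumU (x := b))|left|right].
have [||L [sL Lx LN [a [La nAa]]]] :=
  @does_not_block_reach _ _ _ (~` A) _ (nb x nNx).
- exact: subcontinuum_openC.
- by exists q.
have Ka : K a by have [] // : (K `|` A) a by rewrite KA.
have LK : L `|` K = [set: X].
  apply: (irreducible_ends (p := p) (q := q) (x := x) (y := y)) => //.
  - exact: (subcontinuumU (x := a)).
  - by left.
  - by right.
have : (L `|` K) n by rewrite LK.
by case=> [/LN|/KN].
Qed.

(** A point [y] of [N] outside the end would be joined to [q], and through [B]
to [d] as well, by a proper continuum [L `|` B].  A continuum [S] through [p]
disjoint from it can be reached from [d] by a continuum that avoids [N]; the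
union joins [d] to [p], so it is the whole space, and yet it misses [y]. *)
Lemma NBF1_one_end (R : realType) (X : metricType R) (p q d : X) (N : set X) :
  continuum X -> decomposable X -> irreducible_between p q -> NBF1 X N ->
  ~` composant q `<=` N -> irreducible_between d p -> ~ N d ->
  N `<=` ~` composant q.
Proof.
move=> cX dX irr NN qN irrd nNd y Ny /composantP[L [sL LT Lq Ly]].
have [A [B [sA sB AB [Ap nAq Bq nBp] _]]] :=
  irreducible_decomposition cX dX irr.
have [_ _ nb] := NN.
have sLB : subcontinuum (L `|` B) by exact: (subcontinuumU (x := q)).
have nLBp : ~ (L `|` B) p by move=> [Lp|//]; apply: LT; exact: irr.
have LBq : (L `|` B) q by left.
have [|S [O [sS Sp SLB [oO O0 OS]]]] := NBF1_end_continuum cX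
    (irreducible_betweenC irr) NN qN sLB LBq.
  by move=> LBT; apply: nLBp; rewrite LBT.
have [K [sK Kd KN [o [Ko Oo]]]] := does_not_block_reach (nb d nNd) oO O0.
have KS : K `|` S = [set: X].
  by apply: irrd; [exact: (subcontinuumU sK sS Ko (OS _ Oo))|left|right].
have : (K `|` S) y by rewrite KS.
by case=> [/KN|/SLB]; apply=> //; left.
Qed.

(** The point [y] is joined to [q] by [L] and to [p] by [M]; the continua [S]
and [S'] at the two ends avoid [L] and [M], and are connected with each other
through [x] outside [N], which leaves no room for [y]. *)
Lemma NBF1_both_ends (R : realType) (X : metricType R) (p q : X) (N : set X) :
  continuum X -> irreducible_between p q -> NBF1 X N ->
  ~` composant q `<=` N -> ~` composant p `<=` N ->
  N `<=` ~` composant q `|` ~` composant p.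
Proof.
move=> cX irr NN qN pN y Ny; apply: contrapT => /not_orP[/contrapT + /contrapT].
move=> /composantP[L [sL LT Lq Ly]] /composantP[M [sM MT Mp My]].
have [x nNx] := NBF1_proper NN; have [_ _ nb] := NN.
have [S [O [sS Sp SL [oO O0 OS]]]] :=
  NBF1_end_continuum cX (irreducible_betweenC irr) NN qN sL Lq LT.
have [S' [O' [sS' S'q S'M [oO' O'0 O'S']]]] :=
  NBF1_end_continuum cX irr NN pN sM Mp MT.
have [K [sK Kx KN [o [Ko Oo]]]] := does_not_block_reach (nb x nNx) oO O0.
have [K' [sK' K'x K'N [o' [K'o' O'o']]]] :=
  does_not_block_reach (nb x nNx) oO' O'0.
have sKS := subcontinuumU sK sS Ko (OS _ Oo).
have sKS' := subcontinuumU sK' sS' K'o' (O'S' _ O'o').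
have KT : (K `|` S) `|` (K' `|` S') = [set: X].
  apply: irr; [|by left; right|by right; right].
  by apply: (subcontinuumU (x := x)) => //; left.
have : ((K `|` S) `|` (K' `|` S')) y by rewrite KT.
by case=> [[/KN|/SL]|[/K'N|/S'M]]; exact.
Qed.

(** * Closed ends give members *)

Lemma end_in_NBF1 (R : realType) (X : metricType R) (p q : X) :
  continuum X -> p <> q -> irreducible_between p q ->
  closed (~` composant q) -> NBF1 X (~` composant q).
Proof.
move=> cX pq irr clC; split.
- by split => //; exists p; apply/notin_composantP.
- move=> CT; have : (~` composant q) q by rewrite CT.
  by apply; exact: composant_refl pq.
- move=> x /contrapT /composantP[L [sL LT Lq Lx]] O O0 oO.
  have [y [Oy /composantP[M [sM MT Mq My]]]] := composant_dense cX pq O0 oO.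
  exists y; split => //; exists (L `|` M); last by right.
  split; [exact: (subcontinuumU (x := q))|by left|].
  by move=> z [Lz|Mz]; apply; apply/composantP; [exists L|exists M].
Qed.

(** A proper continuum [L] through [q] and [x] avoids the end at [p].  If the
closure missed the other end, bumping inside [L] from [x] towards that end
would produce a continuum that avoids both ends and leaves the closure. *)
Lemma unblocked_meets_end (R : realType) (X : metricType R) (p q x : X) :
  continuum X -> irreducible_between p q -> closed (~` composant p) ->
  composant q x -> composant p x ->
  closure (\bigcup_(L in [set L : set X |
       [/\ subcontinuum L, L x &
           L `<=` ~` (~` composant q `|` ~` composant p)]]) L)
    `&` ~` composant p !=set0.
Proof.
move=> cX irr clD /composantP[L [sL LT Lq Lx]] px.
set G := \bigcup_(L in _) L; apply: contrapT => nGD.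
have [||||S [sS Sx SL SD [y [Sy nGy]]]] :=
  @subcontinuum_bumping _ _ L _ (~` closure G) x cX sL Lx clD.
- by apply.
- exact/closed_openC/closed_closure.
- by move=> y Dy Gy; apply: nGD; exists y.
- exists q; split => //; apply/notin_composantP; exact: irreducible_betweenC.
apply: nGy; apply: subset_closure; exists S => //; split => //.
move=> z Sz [|Dz]; last exact: (SD z).
by apply; apply/composantP; exists L; split => //; exact: SL.
Qed.

Lemma both_ends_in_NBF1 (R : realType) (X : metricType R) (p q : X) :
  continuum X -> decomposable X -> irreducible_between p q ->
  closed (~` composant q) -> closed (~` composant p) ->
  NBF1 X (~` composant q `|` ~` composant p).
Proof.
move=> cX dX irr clC clD.
have [A [B [sA sB AB [Ap nAq Bq nBp] [m [Am Bm]]]]] :=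
  irreducible_decomposition cX dX irr.
split.
- by split; [exists p; left; apply/notin_composantP|exact: closedU].
- move=> CDT; have : (~` composant q `|` ~` composant p) m by rewrite CDT.
  case; apply; apply/composantP; [exists B|exists A]; split => // ET.
    by apply: nBp; rewrite ET.
  by apply: nAq; rewrite ET.
move=> x /not_orP[/contrapT qx /contrapT px].
rewrite /does_not_block.
have [c [Yc Cc]] := unblocked_meets_end cX (irreducible_betweenC irr) clC px qx.
have [d [Yd Dd]] := unblocked_meets_end cX irr clD qx px.
move: Yc; rewrite [~` composant p `|` _]setUC => Yc.
set G := \bigcup_(L in _) L in Yc Yd *.
have YT : closure G = [set: X].
  apply: (irreducible_ends (p := p) (q := q) (x := c) (y := d)) => //;
    [exact/notin_composantP|exact/notin_composantP|].
  split; [by exists c|exact: closed_closure|apply: connected_closure].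
  apply: bigcup_connected; first by exists x => L [].
  by move=> L [[]].
move=> O [o Oo] oO; have : closure G o by rewrite YT.
by rewrite setIC; apply; apply: open_nbhs_nbhs; split.
Qed.

(** Each part of the decomposition contains one end and misses the other, so an
end is the trace of the union of the ends on a closed set. *)
Lemma closed_end_of_union (R : realType) (X : metricType R) (p q : X) :
  continuum X -> decomposable X -> irreducible_between p q ->
  closed (~` composant q `|` ~` composant p) -> closed (~` composant q).
Proof.
move=> cX dX irr clCD.
have [A [B [sA sB AB [Ap nAq Bq nBp] _]]] :=
  irreducible_decomposition cX dX irr.
have -> : ~` composant q = (~` composant q `|` ~` composant p) `&` A.
  apply/seteqP; split=> y.
    move=> qy; split; first by left.
    have : (A `|` B) y by rewrite AB.
    case=> // By; case: qy; apply/composantP; exists B; split => // BT.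
    by apply: nBp; rewrite BT.
  move=> [[//|py] Ay]; case: py; apply/composantP; exists A; split => // AT.
  by apply: nAq; rewrite AT.
by apply: closedI => //; exact: subcontinuum_closed.
Qed.

(** * The classification and its cardinalities *)

Lemma NBF1E (R : realType) (X : metricType R) (p q : X) (N : set X) :
  continuum X -> decomposable X -> irreducible_between p q ->
  NBF1 X N <-> [\/ N = ~` composant q /\ closed (~` composant q),
    N = ~` composant p /\ closed (~` composant p) |
    [/\ N = ~` composant q `|` ~` composant p, closed (~` composant q)
      & closed (~` composant p)]].
Proof.
move=> cX dX irr; have irr' := irreducible_betweenC irr.
have pq : p <> q.
  have [A [B [_ _ _ [Ap nAq _ _] _]]] := irreducible_decomposition cX dX irr.
  by move=> pq; apply: nAq; rewrite -pq.
split; last first.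
  case=> [[-> clC]|[-> clD]|[-> clC clD]].
  - exact: (end_in_NBF1 (p := p)).
  - by apply: (end_in_NBF1 (p := q)) => // /esym.
  - exact: both_ends_in_NBF1.
move=> NN; have [[_ clN] _ _] := NN.
have [CN|CN] := pselect (~` composant q `<=` N).
  have [DN|DN] := pselect (~` composant p `<=` N).
    have E : N = ~` composant q `|` ~` composant p.
      apply/seteqP; split; first exact: NBF1_both_ends.
      by rewrite subUset.
    apply: Or33; rewrite E in clN; split => //.
      exact: closed_end_of_union clN.
    by apply: (closed_end_of_union (q := p) (p := q)) => //; rewrite setUC.
  have [d Dd nNd] : exists2 d, (~` composant p) d & ~ N d.
    apply: contrapT => H; apply: DN => d Dd; apply: contrapT => nNd.
    by apply: H; exists d.
  have E : N = ~` composant q.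
    apply/seteqP; split => //; apply: (NBF1_one_end (p := p) (d := d)) => //.
    exact/notin_composantP.
  by apply: Or31; rewrite -E.
have [c Cc nNc] : exists2 c, (~` composant q) c & ~ N c.
  apply: contrapT => H; apply: CN => c Cc; apply: contrapT => nNc.
  by apply: H; exists c.
have DN : ~` composant p `<=` N.
  move=> d Dd.
  by case: (@NBF1_contains_end _ _ p q c d N) => //; exact/notin_composantP.
have E : N = ~` composant p.
  apply/seteqP; split => //; apply: (NBF1_one_end (p := q) (d := c)) => //.
  exact/notin_composantP.
by apply: Or32; rewrite -E.
Qed.

Lemma card_setU1S (T : Type) (A : set T) (x : T) (n : nat) :
  ~ A x -> A #= `I_n -> x |` A #= `I_n.+1.
Proof.
move=> nAx An; apply/eq_cardSP; exists x; first by left.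
by rewrite setUKD // => y [->].
Qed.

Lemma card_II_inj (T : Type) (A : set T) (m n : nat) :
  A #= `I_m -> A #= `I_n -> m = n.
Proof. by move=> Am An; apply/card_eq_II; rewrite -(card_eql Am). Qed.

Unset Implicit Arguments.

Theorem theorem4p6 (R : realType) (X : metricType R)
    (contX : continuum X) (decX : decomposable X) (p q : X)
    (hpq : forall L : set X, proper_subcontinuum L -> ~ (L p /\ L q)) :
  let C := ~` composant q in
  let D := ~` composant p in
  [/\ ([set C; D] `<=` hyperspace X <-> NBF1 X #= `I_3) /\
      ([set C; D] `<=` hyperspace X -> NBF1 X = [set C; D; C `|` D]),
      ([set C; D] `&` hyperspace X #= `I_1 <-> NBF1 X #= `I_1) /\
      ([set C; D] `&` hyperspace X #= `I_1 ->
         NBF1 X = [set C; D] `&` hyperspace X) &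
      ([set C; D] `&` hyperspace X = set0 <-> NBF1 X = set0)].
Proof.
move=> C D.
have irr : irreducible_between p q.
  by move=> L sL Lp Lq; apply: contrapT => LT; apply: (hpq L).
have Cp : C p by apply/notin_composantP.
have Dq : D q by apply/notin_composantP; exact: irreducible_betweenC.
have CD0 x : C x -> ~ D x.
  move=> /notin_composantP Cx /notin_composantP.
  exact: (ends_disjoint (p := p) (q := q)).
have hC : hyperspace X C <-> closed C.
  by split=> [[]//|clC]; split => //; exists p.
have hD : hyperspace X D <-> closed D.
  by split=> [[]//|clD]; split => //; exists q.
have NBE N := NBF1E N contX decX irr.
have nCD : C <> D by move=> CD; apply: (CD0 p) => //; rewrite -CD.
have nCU : ~ [set C; D] (C `|` D).
  move=> [E|E].
    by apply: (CD0 q) => //; rewrite -E; right.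
  by apply: (CD0 p) => //; rewrite -E; left.
have cardT0 (n : nat) : (@set0 (set X)) #= `I_n -> n = 0%N.
  by move=> c0; apply: (card_II_inj c0); rewrite II0.
set E := [set C; D] `&` hyperspace X.
(* Only whether both ends are closed matters: if not, the closed ends are
   exactly the members, and there is at most one of them. *)
have [[Shyp NB3]|[nShyp NBEq E01]] :
    ([set C; D] `<=` hyperspace X /\ NBF1 X = [set C; D; C `|` D]) \/
    [/\ ~ [set C; D] `<=` hyperspace X, NBF1 X = E & E = set0 \/ E #= `I_1].
- have [clC|nclC] := pselect (closed C); have [clD|nclD] := pselect (closed D).
  + left; split; first by move=> _ [->|->]; [apply/hC|apply/hD].
    apply/seteqP; split=> N.
      by move=> /NBE [[-> _]|[-> _]|[-> _ _]]; [left; left|left; right|right].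
    move=> H; apply/NBE.
    by case: H => [[->|->]|->]; [apply: Or31|apply: Or32|apply: Or33].
  + have EC : E = [set C].
      apply/seteqP; split=> N; last by move=> ->; split; [left|exact/hC].
      by move=> [[->//|->] /hD].
    right; split; last by right; rewrite EC; exact: card_set1.
      by move=> /(_ D (or_intror erefl)) /hD.
    rewrite EC; apply/seteqP; split=> N.
      by move=> /NBE [[]|[]|[]].
    by move=> ->; apply/NBE; apply: Or31.
  + have ED : E = [set D].
      apply/seteqP; split=> N; last by move=> ->; split; [right|exact/hD].
      by move=> [[->|->//] /hC].
    right; split; last by right; rewrite ED; exact: card_set1.
      by move=> /(_ C (or_introl erefl)) /hC.
    rewrite ED; apply/seteqP; split=> N.
      by move=> /NBE [[]|[]|[]].
    by move=> ->; apply/NBE; apply: Or32.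
  + have E0 : E = set0.
      by rewrite -subset0 => N [[->|->]]; [move/hC|move/hD].
    right; split; last by left.
      by move=> /(_ C (or_introl erefl)) /hC.
    by rewrite E0 -subset0 => N /NBE [[]|[]|[]].
- have E2 : E #= `I_2.
    have -> : E = C |` [set D] by exact/setIidPl.
    by apply: card_setU1S => //; exact: card_set1.
  have NBc : NBF1 X #= `I_3.
    rewrite NB3 setUC; apply: card_setU1S => //.
    by apply: card_setU1S => //; exact: card_set1.
  split; first by split.
    by split; [split=> [/(card_II_inj E2)|/(card_II_inj NBc)]
              |move=> /(card_II_inj E2)].
  by split=> E0; [move: E2|move: NBc]; rewrite E0 => /cardT0.
- split; last by rewrite NBEq.
    split; last by [].
    split=> //; rewrite NBEq => E3; exfalso.
    by case: E01 => [E0|/(card_II_inj E3)//]; move: E3; rewrite E0 => /cardT0.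
  by rewrite NBEq.
Qed.
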